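(* Let $K$ be a field, let $R=K[x_1,\dots,x_n]$, and let $I$ be a nonzero proper ideal of $R$ generated by squarefree monomials. Let $M=\{f_1,\dots,f_s\}$ be the set of minimal monomial generators of $I$ and let $I_1,\dots,I_r$ be the minimal primes of $I$. For $i=1,\dots,n$ set $M_i=\{f_j : x_i \text{ divides } f_j\}$. Define $$\nu(I)=\min_{1\le j\le r}\ \max\{|M_i| : x_i\in I_j\},\qquad \rho(I)=\max_{1\le j\le s}\ \min\{|M_i| : x_i \text{ divides } f_j\}.$$ Then $\nu(I)=\rho(I)$. *)

(* Defs.v *)
From mathcomp Require Export all_boot all_order all_algebra.
From mathcomp Require Export finmap.
From mathcomp Require Export boolp classical_sets.
From mathcomp Require Export ring_quotient mpoly.

Set Implicit Arguments.
Unset Strict Implicit.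
Unset Printing Implicit Defensive.

Import GRing.Theory.

Local Open Scope classical_set_scope.
Local Open Scope ring_scope.

Section Ideals.

Variable R : comNzRingType.

Definition ideal_generated_by (S : set R) : set R :=
  [set p | exists2 s : seq (R * R),
     (forall u, u \in s -> S u.2) & p = \sum_(u <- s) u.1 * u.2].

(* [idealr_closed] already includes properness (it requires 1 \notin P). *)
Definition prime_ideal (P : set R) : Prop :=
  idealr_closed (mem P) /\ prime_idealr_closed (mem P).

Definition minimal_primes (I : set R) : set (set R) :=
  [set P | [/\ prime_ideal P, I `<=` P &
     forall Q : set R, prime_ideal Q -> I `<=` Q -> Q `<=` P -> Q = P]].

End Ideals.

(* The least element of a nonempty set of natural numbers (0 if it is empty). *)
Definition min_nat (A : set nat) : nat :=
  xget 0%N [set k | A k /\ forall l, A l -> (k <= l)%N].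

(* A monomial x_1^(m 1) ... x_n^(m n) is represented by its exponent vector
   m : 'X_{1..n}; divisibility of monomials is then the componentwise order
   (_ <= _)%MM, and U_(i) is the exponent vector of the variable x_i. *)
Section Monomials.

Variables (K : fieldType) (n : nat).

Definition squarefree (m : 'X_{1..n}) : Prop := forall i, (m i <= 1)%N.

Definition monomial_ideal (S : set 'X_{1..n}) : set {mpoly K[n]} :=
  ideal_generated_by [set 'X_[K, m] | m in S].

Definition generated_by_squarefree_monomials (I : set {mpoly K[n]}) : Prop :=
  exists2 S : set 'X_{1..n},
    (forall m, S m -> squarefree m) & I = monomial_ideal S.

Definition minimal_monomial_generators
    (I : set {mpoly K[n]}) (M : {fset 'X_{1..n}}) : Prop :=
  I = monomial_ideal [set` M] /\
  forall N : {fset 'X_{1..n}},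
    {subset N <= M} -> I = monomial_ideal [set` N] -> N = M.

Definition gens_divisible_by (M : {fset 'X_{1..n}}) (i : 'I_n) :
    {fset 'X_{1..n}} :=
  [fset m in M | (U_(i) <= m)%MM]%fset.

Definition nu (I : set {mpoly K[n]}) (M : {fset 'X_{1..n}}) : nat :=
  min_nat [set (\max_(i < n | 'X_i \in P) #|` gens_divisible_by M i |)%N
          | P in minimal_primes I].

Definition rho (M : {fset 'X_{1..n}}) : nat :=
  (\max_(f <- M)
     min_nat [set #|` gens_divisible_by M i |
             | i in [set i : 'I_n | (U_(i) <= f)%MM]])%N.

End Monomials.

(* Main.v *)
Require Import Defs.

Set Implicit Arguments.
Unset Strict Implicit.
Unset Printing Implicit Defensive.

Import GRing.Theory.

(** Call a set C of variables a cover when every generator f in M is divisible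
    by a variable of C, and weigh the variable i by |M_i|.  The equality is the
    bottleneck min-max theorem relating the generators to their covers.

    A prime containing I contains every f in M, hence a variable dividing f
    ([prime_mpolyXP]); the weight of that variable lies between the minimum
    taken over f and the maximum taken over the prime.  Hence rho <= nu.

    Conversely, the variables of weight at most rho form a cover, because the
    least weight among the variables dividing f is at most rho, by definition
    of rho.  A cover minimal for inclusion spans a minimal prime of I
    ([minimal_cover_minimal_prime]), so a minimal cover made of variables of
    weight at most rho gives a minimal prime whose variables all have weight at
    most rho ([cover_minimal_prime]).  Hence nu <= rho.  Passing to a minimal
    cover is a finite process, so no chain argument on prime ideals occurs. *)

Local Open Scope classical_set_scope.
Local Open Scope ring_scope.

(** * Minima of sets of natural numbers *)

Lemma min_natP (A : set nat) (k : nat) :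
  A k -> A (min_nat A) /\ forall l, A l -> (min_nat A <= l)%N.
Proof.
move=> Ak; have exA : exists j, `[< A j >] by exists k; apply/asboolP.
apply: (@xgetPex _ 0%N [set k | A k /\ forall l, A l -> (k <= l)%N]).
case: (ex_minnP exA) => j /asboolP Aj minj; exists j; split=> // l Al.
by apply: minj; apply/asboolP.
Qed.

(** * Membership in ideals *)

Section Ideals.

Variables (R : comNzRingType) (Q : set R).
Hypothesis idQ : idealr_closed (mem Q).

Lemma idealD u v : Q u -> Q v -> Q (u + v).
Proof.
case: idQ => _ _ clQ Qu Qv; have := clQ 1 u v (mem_set Qu) (mem_set Qv).
by rewrite mul1r => /set_mem.
Qed.

Lemma idealMl a u : Q u -> Q (a * u).
Proof.
case: idQ => Q0 _ clQ Qu; have := clQ a u 0 (mem_set Qu) Q0.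
by rewrite addr0 => /set_mem.
Qed.

Lemma ideal_generated_by_min (S : set R) :
  S `<=` Q -> ideal_generated_by S `<=` Q.
Proof.
move=> SQ p [s sS ->]; rewrite big_seq; apply: big_ind => [|u v|u us].
- by case: idQ => /set_mem.
- exact: idealD.
- by apply: idealMl; apply/SQ/sS.
Qed.

End Ideals.

Lemma sub_ideal_generated_by (R : comNzRingType) (S : set R) :
  S `<=` ideal_generated_by S.
Proof.
move=> p Sp; exists [:: (1, p)]; first by move=> u; rewrite inE => /eqP ->.
by rewrite big_seq1 mul1r.
Qed.

(** * Primes spanned by variables *)

Section Covers.

Variables (K : fieldType) (n : nat).
Implicit Types (C : {set 'I_n}) (m : 'X_{1..n}) (M : {fset 'X_{1..n}}).

Lemma ideal_mpolyX_dvd (Q : set {mpoly K[n]}) i m :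
  idealr_closed (mem Q) -> Q 'X_i -> (U_(i) <= m)%MM -> Q 'X_[K, m].
Proof. by move=> idQ Qi /submK <-; rewrite mpolyXD; apply: idealMl. Qed.

(** A monomial is a product of variables, so a prime that contains it contains
    one of its factors. *)
Lemma prime_mpolyXP (Q : set {mpoly K[n]}) m :
  prime_ideal Q ->
  Q 'X_[K, m] <-> exists2 i : 'I_n, (U_(i) <= m)%MM & Q 'X_i.
Proof.
move=> [idQ prQ]; split=> [|[i im Qi]]; last exact: ideal_mpolyX_dvd im.
have Q1 : ~ Q 1 by case: idQ => _ /negP nQ1 _ /mem_set.
have prM u v : Q (u * v) -> Q u \/ Q v.
  by move=> /mem_set /prQ /orP[] /set_mem; [left|right].
rewrite mpolyXE_id.
apply: (big_ind (fun p => Q p -> exists2 i : 'I_n, (U_(i) <= m)%MM & Q 'X_i)).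
- by [].
- by move=> u v IHu IHv /prM[].
move=> i _ Qi; exists i; first by rewrite lep1mP; case: eqP Qi => // ->.
by elim: (m i) Qi => [/Q1|k IHk] //; rewrite exprS => /prM[].
Qed.

Definition kill C (p : {mpoly K[n]}) : {mpoly K[n]} :=
  p \mPo [tuple if i \in C then 0 else 'X_i | i < n].

(** The ideal spanned by the variables of C.  As the kernel of an endomorphism
    of a domain, it is visibly prime. *)
Definition cover_prime C : set {mpoly K[n]} := [set p | kill C p = 0].

Lemma killX C i : kill C 'X_i = if i \in C then 0 else 'X_i.
Proof. by rewrite /kill comp_mpolyXU -tnth_nth tnth_mktuple. Qed.

Lemma killM C : {morph kill C : p q / p * q}.
Proof. by move=> p q; rewrite /kill rmorphM. Qed.

Lemma cover_primeX C i : cover_prime C 'X_i <-> i \in C.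
Proof.
rewrite /cover_prime /= killX; split=> [|->] //; case: ifP => // _ /eqP.
by rewrite -mpolyC0 -msupp_eq0 msuppX.
Qed.

Lemma cover_prime_prime C : prime_ideal (cover_prime C).
Proof.
split; first split.
- by apply/mem_set; rewrite /cover_prime /= /kill comp_mpoly0.
- apply/negP => /set_mem; rewrite /cover_prime /= /kill comp_mpoly1 => /eqP.
  by rewrite oner_eq0.
- move=> a u v /set_mem u0 /set_mem v0; apply/mem_set.
  rewrite /cover_prime /= in u0 v0 *.
  by rewrite /kill comp_mpolyD -!/(kill _ _) killM u0 v0 mulr0 addr0.
move=> u v /set_mem; rewrite /cover_prime /= killM => /eqP.
by rewrite mulf_eq0 => /orP[] /eqP uv0; apply/orP; [left|right]; apply/mem_set.
Qed.

(** Killing the variables of C changes a monomial only when one of them divides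
    it, and then the monomial lies in Q already; so [kill C p] is congruent to
    [p] modulo Q for every [p], and the kernel is contained in Q. *)
Lemma cover_prime_min C (Q : set {mpoly K[n]}) :
  idealr_closed (mem Q) -> (forall i, i \in C -> Q 'X_i) ->
  cover_prime C `<=` Q.
Proof.
move=> idQ CQ p p0; suff: Q (p - kill C p) by rewrite p0 subr0.
have Q0 : Q 0 by case: idQ => /set_mem.
elim/mpolyind: p {p0} => [|c m p _ _ IHp].
  by rewrite /kill comp_mpoly0 subr0.
rewrite /kill comp_mpolyD comp_mpolyZ -!/(kill _ _) opprD addrACA -scalerBr.
apply: idealD => //; rewrite -mul_mpolyC; apply: idealMl => //.
have [[i iC im]|noC] := pselect (exists2 i, i \in C & (U_(i) <= m)%MM).
  have /= -> : cover_prime C 'X_[K, m].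
    apply/prime_mpolyXP; first exact: cover_prime_prime.
    by exists i => //; apply/cover_primeX.
  by rewrite subr0; apply: ideal_mpolyX_dvd im => //; apply: CQ.
suff -> : kill C 'X_[K, m] = 'X_[K, m] by rewrite subrr.
rewrite /kill comp_mpolyX [RHS]mpolyXE_id; apply: eq_bigr => i _.
rewrite tnth_mktuple; case: ifPn => // iC.
case: (eqVneq (m i) 0%N) => [->|mi]; first by rewrite !expr0.
by case: noC; exists i => //; rewrite lep1mP.
Qed.

Definition covers M C : bool :=
  [forall f : M, [exists i in C, (U_(i) <= val f)%MM]].

Lemma coversP M C :
  reflect (forall f, f \in M -> exists2 i, i \in C & (U_(i) <= f)%MM)
          (covers M C).
Proof.
apply: (iffP forallP) => [cov f fM|cov f].
  by have /existsP[i /andP[]] := cov [` fM]%fset; exists i.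
by have [i iC im] := cov _ (valP f); apply/existsP; exists i; rewrite iC.
Qed.

Lemma prime_contains_monomial_ideal M (Q : set {mpoly K[n]}) :
  prime_ideal Q ->
  monomial_ideal [set` M] `<=` Q <->
  (forall f, f \in M -> exists2 i : 'I_n, (U_(i) <= f)%MM & Q 'X_i).
Proof.
move=> prQ; split=> [IQ f fM|cov].
  by apply/prime_mpolyXP => //; apply/IQ/sub_ideal_generated_by; exists f.
apply: ideal_generated_by_min; first by case: prQ.
by move=> _ [f fM <-]; apply/prime_mpolyXP => //; apply: cov.
Qed.

(** The variables of a prime Q between I and the prime of C form a cover inside
    C, so by minimality they are all of C, and they generate the prime of C. *)
Lemma minimal_cover_minimal_prime M C :
  minset (covers M) C ->
  minimal_primes (monomial_ideal [set` M]) (cover_prime C).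
Proof.
move=> /minsetP[/coversP covC minC]; split; first exact: cover_prime_prime.
  apply/prime_contains_monomial_ideal; first exact: cover_prime_prime.
  by move=> f /covC[i iC im]; exists i => //; apply/cover_primeX.
move=> Q prQ /prime_contains_monomial_ideal IQ QC.
have [idQ _] := prQ; apply/seteqP; split=> //; apply: cover_prime_min => //.
pose D : {set 'I_n} := [set i | `[< Q 'X_i >]]%SET.
suff <- : D = C by move=> i; rewrite inE => /asboolP.
apply: minC.
  apply/coversP => f /(IQ prQ)[i im Qi].
  by exists i => //; rewrite inE; apply/asboolP.
by apply/fintype.subsetP => i; rewrite inE => /asboolP /QC /cover_primeX.
Qed.

Lemma cover_minimal_prime M C :
  covers M C ->
  exists2 P : set {mpoly K[n]}, minimal_primes (monomial_ideal [set` M]) P &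
    forall i, P 'X_i -> i \in C.
Proof.
case/minset_exists => D minD /fintype.subsetP DC; exists (cover_prime D).
  exact: minimal_cover_minimal_prime.
by move=> i /cover_primeX /DC.
Qed.

Lemma monomial_ideal_one M :
  0%MM \in M -> monomial_ideal [set` M] = [set: {mpoly K[n]}].
Proof.
move=> M0; apply/seteqP; split=> // p _; exists [:: (p, 1)].
  move=> u; rewrite inE => /eqP -> /=; exists 0%MM => //; exact: mpolyX0.
by rewrite big_seq1 mulr1.
Qed.

End Covers.

(** * The min-max equality *)

Theorem proposition1 (K : fieldType) (n : nat)
    (I : set {mpoly K[n]})
    (I_sqfree : generated_by_squarefree_monomials I)
    (I_nonzero : I <> [set 0])
    (I_proper : I <> setT)
    (M : {fset 'X_{1..n}})
    (M_gens : minimal_monomial_generators I M) :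
  nu I M = rho M.
Proof.
have [IE _] := M_gens; rewrite {}IE in I_proper *.
pose w i := #|` gens_divisible_by M i |.
(* As I is proper, no generator is the monomial 1; so some variable divides f
   and the minimum over f is attained rather than the default value 0. *)
have minW f : f \in M ->
    let A := [set w i | i in [set i : 'I_n | (U_(i) <= f)%MM]] in
    A (min_nat A) /\ forall l, A l -> (min_nat A <= l)%N.
  move=> fM A; have [i im] : exists i : 'I_n, (U_(i) <= f)%MM.
    have [//|nof] := pselect (exists i : 'I_n, (U_(i) <= f)%MM).
    case: I_proper; apply: monomial_ideal_one.
    suff <- : f = 0%MM by [].
    apply/mnmP => i; rewrite mnm0E; apply/eqP; apply: contraT => fi.
    by case: nof; exists i; rewrite lep1mP.
  by apply: (@min_natP A (w i)); exists i.
pose C : {set 'I_n} := [set i | (w i <= rho M)%N]%SET.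
have covC : covers M C.
  apply/coversP => f fM; have [[i im wi] _] := minW f fM.
  by exists i => //; rewrite inE wi /rho; apply: (leq_bigmax_seq _ fM).
have [P minP PC] := cover_minimal_prime K covC.
rewrite /nu; set B := [set _ | P in _].
have [[Q [prQ IQ _] nuE] nu_min] :
    B (min_nat B) /\ forall l, B l -> (min_nat B <= l)%N.
  by apply: min_natP; exists P.
apply/eqP; rewrite eqn_leq; apply/andP; split.
  apply: leq_trans (nu_min _ (imageP _ minP)) _.
  by apply/bigmax_leqP => i /set_mem /PC; rewrite inE.
rewrite -nuE; apply/bigmax_leqP_seq => f fM _.
have [i im Qi] := (prime_contains_monomial_ideal M prQ).1 IQ f fM.
have [_ minf] := minW f fM.
apply: leq_trans (minf (w i) _) _; first by exists i.
exact: (leq_bigmax_cond _ (mem_set Qi)).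
Qed.
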